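(* Let $r\ge 2$, let $\bm{\nu}=(\mu_1,\dots,\mu_{r-1})\in\mathcal{L}^{r-1}$ with $\mu_j\in\mathcal{L}_{N_j}$, $N_j\le\infty$, and let $\mu_r\in\mathcal{L}_m$ with $m<\infty$. Let $\Phi$ be the unique monic orthogonal polynomial of degree $m$ with respect to $\mu_r$, and let $\bm{\mu}=(\mu_1,\dots,\mu_{r-1},\mu_r)$ and $\widehat{\bm{\nu}}=(\Phi\mu_1,\dots,\Phi\mu_{r-1})$. Let $\bm{k}\in\mathbb{N}^{r-1}$ with $k_j\le N_j$ for all $j$. Then the index $(\bm{k},m)\in\mathbb{N}^r$ is normal for $\bm{\mu}$ if and only if $\bm{k}$ is normal for $\widehat{\bm{\nu}}$. In that case $$P_{(\bm{k},m)}(x)=\Phi(x)\widehat{P}_{\bm{k}}(x),$$ where $P_{(\bm{k},m)}$ is the monic type II multiple orthogonal polynomial of $\bm{\mu}$ at $(\bm{k},m)$ and $\widehat{P}_{\bm{k}}$ is the monic type II multiple orthogonal polynomial of $\widehat{\bm{\nu}}$ at $\bm{k}$.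
   Context: $\mathbb{N}=\{0,1,2,\dots\}$. A moment functional is a linear map $\mu:\mathbb{C}[x]\to\mathbb{C}$; put $\Delta_n=\det(\mu[x^{i+k}])_{i,k=0}^{n-1}$. For $N\in\{1,2,\dots\}$, $\mathcal{L}_N$ is the set of $\mu$ with $\Delta_n\ne0$ for $1\le n\le N$ and $\Delta_n=0$ for $n>N$; $\mathcal{L}_\infty$ is the set of $\mu$ with $\Delta_n\neq0$ for all $n$; $\mathcal{L}=\mathcal{L}_\infty\cup\bigcup_{N\ge1}\mathcal{L}_N$. For $\mu\in\mathcal L_m$ the monic orthogonal polynomial of degree $m$ is the unique monic $P$ of degree $m$ with $\mu[P(x)x^p]=0$ for $0\le p\le m-1$. For a polynomial $\Phi$, the Christoffel transform $\Phi\mu$ of $\mu$ is the moment functional $f\mapsto\mu[\Phi f]$. For a system $(\mu_1,\dots,\mu_s)$ of moment functionals and $\bm{n}\in\mathbb{N}^s$, $|\bm{n}|=n_1+\dots+n_s$, a type II multiple orthogonal polynomial at $\bm{n}$ is a nonzero polynomial $P$ with $\deg P\le|\bm{n}|$ and $\mu_j[P(x)x^p]=0$ for $0\le p\le n_j-1$, $1\le j\le s$. The index $\bm{n}$ is normal if every such $P$ has degree exactly $|\bm{n}|$; then there is a unique monic one, denoted $P_{\bm{n}}$. ($\bm{0}$ is always normal.) *)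

(* Defs.v *)
From HB Require Import structures.
From mathcomp Require Import all_boot all_order all_algebra.

Set Implicit Arguments.
Unset Strict Implicit.
Unset Printing Implicit Defensive.

Import GRing.Theory.
Local Open Scope ring_scope.

Section MomentFunctionals.
Variable F : fieldType.

Definition moment_functional : Type := {scalar {poly F}}.

Implicit Types (mu : moment_functional) (P Phi : {poly F}).

Definition hankel_det mu (n : nat) : F :=
  \det (\matrix_(i < n, k < n) mu 'X^(i + k)).

(* The index [N] of the class L_N ranges over {1, 2, ...} plus infinity;      *)
(* [None] stands for infinity.                                                *)
Definition in_class (N : option nat) mu : Prop :=
  match N with
  | Some N0 => [/\ (1 <= N0)%N,
      (forall n, (1 <= n <= N0)%N -> hankel_det mu n != 0) &
      (forall n, (N0 < n)%N -> hankel_det mu n = 0)]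
  | None => forall n, hankel_det mu n != 0
  end.

Definition le_class (k : nat) (N : option nat) : bool :=
  if N is Some N0 then (k <= N0)%N else true.

Definition monic_orthogonal mu (m : nat) P : Prop :=
  [/\ P \is monic, size P = m.+1 &
      forall p, (p < m)%N -> mu (P * 'X^p) = 0].

Definition christoffel_fun Phi mu : {poly F} -> F := fun f => mu (Phi * f).

Lemma christoffel_is_linear Phi mu :
  linear_for *%R (christoffel_fun Phi mu).
Proof.
by move=> a f g; rewrite /christoffel_fun mulrDr -scalerAr linearP.
Qed.

HB.instance Definition _ Phi mu :=
  GRing.isLinear.Build F {poly F} F *%R (christoffel_fun Phi mu)
    (christoffel_is_linear Phi mu).

Definition christoffel Phi mu : moment_functional := christoffel_fun Phi mu.

Section MultipleOrthogonality.
Variables (s : nat) (mu : s.-tuple moment_functional) (n : s.-tuple nat).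

Definition type2_mop P : Prop :=
  [/\ P != 0, (size P <= (sumn n).+1)%N &
      forall (j : 'I_s) (p : nat), (p < tnth n j)%N ->
        tnth mu j (P * 'X^p) = 0].

Definition normal_index : Prop :=
  forall P, type2_mop P -> size P = (sumn n).+1.

Definition monic_type2_mop P : Prop := type2_mop P /\ P \is monic.

End MultipleOrthogonality.

End MomentFunctionals.

(* Main.v *)
(* Orthogonality of [Phi] to [X^p] holds for every [p], not only for [p < m]:
   each vanishing Hankel determinant of size [p + 1 > m] gives a nonzero [Q] of
   degree at most [p] orthogonal to [1, ..., X^p]; division by [Phi] shows that
   [Q] is a multiple of [Phi], and a suitable shift of [Q] isolates
   [mu_r (Phi * X^p)]. Hence a polynomial is [mu_r]-orthogonal to all degrees
   below [m] exactly when [Phi] divides it, and [A |-> Phi * A] is a bijection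
   between the type II polynomials of the two systems. *)
Require Import Defs.
From mathcomp Require Import all_boot all_order all_algebra.
From mathcomp Require Import reals complex.

Set Implicit Arguments.
Unset Strict Implicit.
Unset Printing Implicit Defensive.

Import GRing.Theory.
Local Open Scope ring_scope.

(** Serves to separate the orthogonality conditions of the appended functional [mu_r] from those of
    [nu]. *)
Lemma forall_tnth_rcons (S T : Type) (n : nat) (t : n.-tuple S) (u : n.-tuple T)
    (x : S) (y : T) (Q : S -> T -> Prop) :
  (forall j, Q (tnth (rcons_tuple t x) j) (tnth (rcons_tuple u y) j)) <->
  (forall j, Q (tnth t j) (tnth u j)) /\ Q x y.
Proof.
(* With the appended element as default value, [nth] on the shorter tuple is also right at the last
   index. *)
have tnth_rcons (V : Type) (w : n.-tuple V) z (j : 'I_n.+1) :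
    tnth (rcons_tuple w z) j = nth z w j.
  rewrite (tnth_nth z) /= nth_rcons size_tuple.
  case: ltnP => // le_nj; rewrite nth_default ?size_tuple //.
  by case: eqP.
split=> [H | [H Hxy] j].
  split=> [j|].
    have := H (widen_ord (leqnSn n) j).
    by rewrite !tnth_rcons /= -!tnth_nth.
  by have := H ord_max; rewrite !tnth_rcons !nth_default ?size_tuple.
rewrite !tnth_rcons; case: (ltnP j n) => [lt_jn | le_nj].
  by have := H (Ordinal lt_jn); rewrite (tnth_nth x) (tnth_nth y).
by rewrite !nth_default ?size_tuple.
Qed.

(** * Linear algebra of moment matrices and Hankel determinants *)

Section Functionals.
Variable F : fieldType.
Implicit Types (mu : moment_functional F) (P Q A B Phi : {poly F}).

Lemma mul_moment_mx n l (f : 'I_l -> moment_functional F) (v : 'rV[F]_n) j :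
  (v *m \matrix_(i < n, j < l) f j 'X^i) 0 j = f j (rVpoly v).
Proof.
rewrite mxE /rVpoly poly_def linear_sum; apply: eq_bigr => i _.
by rewrite linearZ mxE valK.
Qed.

(** A nonzero row of the left kernel, read as a coefficient vector, is such a polynomial. *)
Lemma exists_common_zero n l (f : 'I_l -> moment_functional F) :
  ~~ row_free (\matrix_(i < n, j < l) f j 'X^i) ->
  exists Q, [/\ Q != 0, (size Q <= n)%N & forall j, f j Q = 0].
Proof.
set M := (X in row_free X); rewrite -kermx_eq0 => kerM.
pose v := nz_row (kermx M).
have v_neq0 : v != 0 by rewrite nz_row_eq0.
exists (rVpoly v); split=> [||j]; last first.
- by rewrite -mul_moment_mx (sub_kermxP (nz_row_sub _)) mxE.
- exact: size_poly.
by apply: contraNneq v_neq0 => v0; rewrite -(rVpolyK v) v0 linear0.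
Qed.

(** Makes the Hankel matrix an instance of the moment matrices above, for the family of Christoffel
    transforms by powers of ['X]. *)
Lemma hankel_mxE mu n :
  \matrix_(i < n, k < n) mu 'X^(i + k)
  = \matrix_(i < n, k < n) christoffel 'X^k mu 'X^i.
Proof. by apply/matrixP => i k; rewrite !mxE exprD mulrC. Qed.

(** The coefficient vector of [B] lies in the left kernel of an invertible matrix. *)
Lemma hankel_nondegenerate mu n B :
  hankel_det mu n != 0 -> (size B <= n)%N ->
  (forall p, (p < n)%N -> mu (B * 'X^p) = 0) -> B = 0.
Proof.
rewrite -unitfE /hankel_det hankel_mxE -[_ \in _]/(_ \in unitmx) => unitH sB Borth.
rewrite -(poly_rV_K sB) -[poly_rV B](mulmxK unitH).
suff -> : poly_rV B *m \matrix_(i < n, k < n) christoffel 'X^k mu 'X^i = 0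
  by rewrite mul0mx linear0.
apply/rowP => j; rewrite (mul_moment_mx (fun k : 'I_n => christoffel 'X^k mu)).
by rewrite poly_rV_K // mxE -[LHS]/(mu ('X^j * B)) mulrC Borth.
Qed.

Lemma hankel_degenerate mu n :
  hankel_det mu n = 0 ->
  exists Q, [/\ Q != 0, (size Q <= n)%N &
    forall p, (p < n)%N -> mu (Q * 'X^p) = 0].
Proof.
move=> H0.
have [|Q [Q0 sQ Qorth]] :=
  @exists_common_zero n n (fun k => christoffel 'X^k mu).
  by rewrite row_free_unit -hankel_mxE unitmxE -/(hankel_det _ _) H0 unitr0.
by exists Q; split=> // p lt_pn; rewrite mulrC -(Qorth (Ordinal lt_pn)).
Qed.

Lemma moment_mul_eq0 mu P A n :
  (forall p, (p < n)%N -> mu (P * 'X^p) = 0) -> (size A <= n)%N ->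
  mu (P * A) = 0.
Proof.
move=> Porth sA; rewrite -[A]coefK poly_def mulr_sumr linear_sum big1 // => i _.
rewrite -scalerAr linearZ /= Porth ?mulr0 //.
exact: leq_trans (ltn_ord i) sA.
Qed.

(** * Annihilation by [Phi] and divisibility by [Phi] *)

Lemma monic_orthogonal_annihilates mu m Phi :
  in_class (Some m) mu -> monic_orthogonal mu m Phi ->
  forall A, mu (Phi * A) = 0.
Proof.
case=> m_gt0 nondeg deg [Phi_monic sPhi Phi_orth] A.
apply: (moment_mul_eq0 _ (leqnn (size A))) => p _.
have [n] := ubnP p; elim: n p => // n IH p lt_pn.
have [lt_pm | le_mp] := ltnP p m; first exact: Phi_orth.
have {IH}IH q : (q < p)%N -> mu (Phi * 'X^q) = 0.
  by move=> lt_qp; apply: IH; exact: leq_trans lt_qp _.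
have Phi_eq0 (D : {poly F}) : (size D <= p)%N -> mu (Phi * D) = 0
    by exact: moment_mul_eq0.
have [Q [Q_neq0 sQ Q_orth]] := hankel_degenerate (deg p.+1 le_mp).
have nondeg_m : hankel_det mu m != 0 by apply: nondeg; rewrite m_gt0 leqnn.
have Q_div := divp_eq Q Phi.
have Phi_neq0 := monic_neq0 Phi_monic.
(* The truncated subtraction in the size of the quotient turns the left side into the maximum of [m]
   and [size Q]. *)
have sQdiv : (size (Q %/ Phi)%R + m <= p.+1)%N.
  by rewrite size_divp // sPhi addnC -maxnE geq_max leqW.
(* For [i < m] the product of the quotient and ['X^i] has size at most [p], so the induction
   hypothesis kills the multiple of [Phi]. The remainder is then orthogonal to all degrees below
   [m], and its size is at most [m]. *)
have rem0 : Q %% Phi = 0.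
  apply: (hankel_nondegenerate nondeg_m) => [|i lt_im].
    by have := ltn_modpN0 Q Phi_neq0; rewrite sPhi.
  have := Q_orth i; rewrite {1}Q_div mulrDl linearD /=.
  rewrite [_ * Phi]mulrC -mulrA Phi_eq0 ?add0r; first by apply; exact: leq_trans lt_im (leqW le_mp).
  have [->|nz] := eqVneq (Q %/ Phi) 0; first by rewrite mul0r size_poly0.
  by rewrite size_mulXn // -ltnS (leq_trans _ sQdiv) // addnC ltn_add2l.
rewrite rem0 addr0 in Q_div.
set D := Q %/ Phi in Q_div sQdiv.
have D_neq0 : D != 0 by apply: contraNneq Q_neq0 => D0; rewrite Q_div D0 mul0r.
have sD : (0 < size D)%N by rewrite size_poly_gt0.
(* The shift gives [E] degree exactly [p]. The exponent is at most [p] because [D] is nonzero, so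
   orthogonality of [Q = D * Phi] applies to it; the terms of [E] below degree [p] vanish by
   induction. *)
set E := D * 'X^(p.+1 - size D).
have sE : size E = p.+1.
  by rewrite size_mulXn // subnK // (leq_trans (leq_addr _ _) sQdiv).
have E_p_neq0 : E`_p != 0.
  have <- : lead_coef E = E`_p by rewrite lead_coefE sE.
  by rewrite lead_coef_Mmonic ?monicXn ?lead_coef_eq0.
have muE : mu (Phi * E) = 0.
  by rewrite mulrA [Phi * D]mulrC -Q_div Q_orth // ltn_subrL sD.
have E_eq : E = \poly_(i < p) E`_i + E`_p *: 'X^p.
  by rewrite -{1}[E]coefK sE !poly_def big_ord_recr.
move: muE; rewrite {1}E_eq mulrDr -scalerAr linearD linearZ /=.
rewrite Phi_eq0 ?size_poly // add0r => /eqP.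
by rewrite mulf_eq0 (negPf E_p_neq0) => /eqP.
Qed.

(** Since [mu] kills every multiple of [Phi], the remainder of [P] inherits its orthogonality, and
    nondegeneracy at size [m] makes it zero. *)
Lemma orthogonal_dvdp mu m Phi P :
  in_class (Some m) mu -> monic_orthogonal mu m Phi ->
  (forall p, (p < m)%N -> mu (P * 'X^p) = 0) -> Phi %| P.
Proof.
move=> mu_class Phi_orth P_orth.
have Phi_ann := monic_orthogonal_annihilates mu_class Phi_orth.
case: mu_class Phi_orth => m_gt0 nondeg _ [Phi_monic sPhi _].
have H : hankel_det mu m != 0 by apply: nondeg; rewrite m_gt0 leqnn.
apply/modp_eq0P; apply: (hankel_nondegenerate H) => [|p lt_pm].
  by have := ltn_modpN0 P (monic_neq0 Phi_monic); rewrite sPhi.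
have := P_orth p lt_pm; rewrite {1}(divp_eq P Phi) mulrDl linearD /=.
by rewrite [_ * Phi]mulrC -mulrA Phi_ann add0r.
Qed.

(** * Existence and uniqueness for an arbitrary system *)

Section Systems.
Variables (s : nat) (mu : s.-tuple (moment_functional F)) (n : s.-tuple nat).

(** There are [sumn n] linear conditions on [(sumn n).+1] coefficients. *)
Lemma exists_type2_mop : exists P, type2_mop mu n P.
Proof.
(* One element for each condition: a functional [j] with an exponent below [tnth n j]. *)
pose I := {j : 'I_s & 'I_(tnth n j)}.
have cardI : #|{: I}| = sumn n.
  rewrite card_tagged -[in RHS](map_tnth_enum n); congr (sumn _).
  by apply: eq_map => j; rewrite card_ord.
pose f (u : I) := christoffel 'X^(tagged u) (tnth mu (tag u)).
have [|P [P_neq0 sP P_orth]] :=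
  @exists_common_zero (sumn n).+1 #|{: I}| (fun i => f (enum_val i)).
  by rewrite -row_leq_rank -ltnNge ltnS -cardI rank_leq_col.
exists P; split=> // j p lt_pn.
have := P_orth (enum_rank (Tagged (fun j => 'I_(tnth n j)) (Ordinal lt_pn))).
by rewrite enum_rankK mulrC.
Qed.

(** The difference of two monic solutions loses its top coefficient; if nonzero, it would be a type
    II polynomial of too small a degree. *)
Lemma unique_monic_type2_mop :
  normal_index mu n -> exists P, unique (monic_type2_mop mu n) P.
Proof.
move=> normal; have [P P_mop] := exists_type2_mop.
have sP := normal P P_mop; have [P_neq0 _ P_orth] := P_mop.
have lP_neq0 : lead_coef P != 0 by rewrite lead_coef_eq0.
exists ((lead_coef P)^-1 *: P); split.
  split; last by rewrite monicE lead_coefZ mulVf.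
  split=> [||j p lt_pn].
  - by rewrite scaler_eq0 invr_eq0 negb_or lP_neq0.
  - by rewrite size_scale ?invr_eq0 // sP.
  by rewrite -scalerAl linearZ /= P_orth ?mulr0.
move=> Q [Q_mop Q_monic]; have sQ := normal Q Q_mop.
have [_ _ Q_orth] := Q_mop.
apply/eqP; rewrite -subr_eq0; apply: contraT => D_neq0.
set D := _ - _ in D_neq0.
have coefD : D`_(sumn n) = 0.
  rewrite coefB coefZ -[sumn n]/((sumn n).+1.-1) -{1}sP -sQ.
  by rewrite -!/(lead_coef _) mulVf // (monicP Q_monic) subrr.
have D_mop : type2_mop mu n D.
  split=> // [|j p lt_pn].
    rewrite (leq_trans (size_polyD _ _)) // size_polyN geq_max sQ leqnn andbT.
    by rewrite size_scale ?invr_eq0 // sP.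
  rewrite mulrBl linearB /= Q_orth // subr0 -scalerAl linearZ /= P_orth //.
  by rewrite mulr0.
have := D_neq0; rewrite -lead_coef_eq0 lead_coefE (normal D D_mop) /=.
by rewrite coefD eqxx.
Qed.

End Systems.

(** * The correspondence [A |-> Phi * A] between the two systems *)

Section Christoffel.
Variables (s : nat) (nu : s.-tuple (moment_functional F)) (k : s.-tuple nat).
Variables (mu_r : moment_functional F) (m : nat) (Phi : {poly F}).
Hypotheses (mu_r_class : in_class (Some m) mu_r).
Hypotheses (Phi_orth : monic_orthogonal mu_r m Phi).

Local Notation mu := (rcons_tuple nu mu_r).
Local Notation km := (rcons_tuple k m).
Local Notation nu_hat := (map_tuple (christoffel Phi) nu).

Let Phi_monic : Phi \is monic. Proof. by case: Phi_orth. Qed.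

Lemma sumn_rcons_index : sumn km = (m + sumn k)%N.
Proof. by rewrite /= sumn_rcons addnC. Qed.

Lemma size_monic_orthogonal_mul A : A != 0 -> size (Phi * A) = (m + size A)%N.
Proof.
move=> A_neq0; case: Phi_orth => _ sPhi _.
by rewrite size_monicM // sPhi.
Qed.

Lemma type2_mop_rcons P :
  type2_mop mu km P <->
  [/\ P != 0, (size P <= (m + sumn k).+1)%N,
      forall (j : 'I_s) p, (p < tnth k j)%N -> tnth nu j (P * 'X^p) = 0 &
      forall p, (p < m)%N -> mu_r (P * 'X^p) = 0].
Proof.
have split_last := forall_tnth_rcons nu k mu_r m
  (fun f l => forall p, (p < l)%N -> f (P * 'X^p) = 0).
rewrite /type2_mop sumn_rcons_index.
by split=> [[? ? /split_last[]] | [? ? ? ?]]; split=> //; apply/split_last.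
Qed.

(** Degree bounds shift by [m], the conditions of [nu] on [Phi * A] are those of [nu_hat] on [A] by
    associativity, and those of [mu_r] hold because [Phi] annihilates. *)
Lemma type2_mop_mul A : type2_mop mu km (Phi * A) <-> type2_mop nu_hat k A.
Proof.
have neq0E : (Phi * A != 0) = (A != 0).
  by rewrite mulf_eq0 (negPf (monic_neq0 Phi_monic)).
have sizeE : A != 0 ->
    (size (Phi * A)%R <= (m + sumn k).+1)%N = (size A <= (sumn k).+1)%N.
  by move=> A_neq0; rewrite size_monic_orthogonal_mul // -addnS leq_add2l.
have orthE (j : 'I_s) p :
    tnth nu_hat j (A * 'X^p) = tnth nu j (Phi * A * 'X^p).
  by rewrite tnth_map -mulrA.
split=> [/type2_mop_rcons[] | [A_neq0 sA A_orth]].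
  rewrite neq0E => A_neq0; rewrite sizeE // => sA A_orth _; split=> // j p lt_pk.
  by rewrite orthE A_orth.
apply/type2_mop_rcons; rewrite neq0E sizeE //; split=> // [j p lt_pk | p _].
  by rewrite -orthE A_orth.
by rewrite -mulrA (monic_orthogonal_annihilates mu_r_class Phi_orth).
Qed.

(** Surjectivity of the correspondence: the conditions of [mu_r] alone force divisibility. *)
Lemma type2_mop_rcons_factor P : type2_mop mu km P -> exists A, P = Phi * A.
Proof.
case/type2_mop_rcons=> _ _ _ P_orth.
exists (P %/ Phi); rewrite mulrC divpK //.
exact: orthogonal_dvdp mu_r_class Phi_orth P_orth.
Qed.

(** The correspondence raises degrees by exactly [m], which is also the difference of the two index
    sums. *)
Lemma normal_index_rcons : normal_index mu km <-> normal_index nu_hat k.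
Proof.
split=> normal.
  move=> A A_mop; have [A_neq0 _ _] := A_mop.
  have /normal := (type2_mop_mul A).2 A_mop.
  by rewrite size_monic_orthogonal_mul // sumn_rcons_index -addnS => /addnI.
move=> P P_mop; have [A def_P] := type2_mop_rcons_factor P_mop.
rewrite def_P in P_mop *.
have A_mop := (type2_mop_mul A).1 P_mop; have [A_neq0 _ _] := A_mop.
by rewrite size_monic_orthogonal_mul // (normal A) // sumn_rcons_index addnS.
Qed.

Lemma monic_type2_mop_mul A :
  monic_type2_mop mu km (Phi * A) <-> monic_type2_mop nu_hat k A.
Proof. by rewrite /monic_type2_mop monicMl // type2_mop_mul. Qed.

Lemma unique_monic_type2_mop_mul A :
  unique (monic_type2_mop nu_hat k) A ->
  unique (monic_type2_mop mu km) (Phi * A).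
Proof.
case=> A_mop A_uniq; split=> [|P P_mop]; first exact/monic_type2_mop_mul.
have [B def_P] := type2_mop_rcons_factor P_mop.1.
by rewrite def_P in P_mop *; rewrite (A_uniq B) //; apply/monic_type2_mop_mul.
Qed.

End Christoffel.
End Functionals.

Theorem theorem3p1 (R : realType) (r : nat) (r_ge2 : (2 <= r)%N)
    (nu : (r.-1).-tuple (moment_functional R[i]))
    (N : (r.-1).-tuple (option nat))
    (nu_class : forall j, in_class (tnth N j) (tnth nu j))
    (mu_r : moment_functional R[i]) (m : nat)
    (mu_r_class : in_class (Some m) mu_r)
    (Phi : {poly R[i]}) (Phi_orth : monic_orthogonal mu_r m Phi)
    (k : (r.-1).-tuple nat)
    (k_le : forall j, le_class (tnth k j) (tnth N j)) :
  let mu := rcons_tuple nu mu_r in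
  let nu_hat := map_tuple (christoffel Phi) nu in
  let km := rcons_tuple k m in
  (normal_index mu km <-> normal_index nu_hat k) /\
  (normal_index mu km ->
   exists P P_hat : {poly R[i]},
     [/\ unique (monic_type2_mop mu km) P,
         unique (monic_type2_mop nu_hat k) P_hat &
         P = Phi * P_hat]).
Proof.
split; first exact: normal_index_rcons mu_r_class Phi_orth.
move=> /(normal_index_rcons nu k mu_r_class Phi_orth) normal_k.
(* The monic polynomial is built for [nu_hat]; multiplication by [Phi] carries it, with its
   uniqueness, to the full system. *)
have [A A_uniq] := unique_monic_type2_mop normal_k.
exists (Phi * A), A; split=> //.
exact: unique_monic_type2_mop_mul mu_r_class Phi_orth A A_uniq.
Qed.
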